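(* The Backward Greedy Heuristic is a 2-approximation algorithm for the 1-DFLP-CCD with identical rewards. That is, on every instance with identical rewards, it runs in polynomial time and returns a feasible location policy $\boldsymbol y^B$ with $2\,z(\boldsymbol y^B)\ge\max_{\boldsymbol y}z(\boldsymbol y)$, the maximum being over all feasible location policies.
   Context: **1-DFLP-CCD** (single-facility Dynamic Facility Location Problem under Cumulative Customer Demand). *Instance:* finite sets $\mathcal{T}=\{1,\ldots,T\}$ (time periods), $\mathcal{I}=\{1,\ldots,I\}$ (locations), $\mathcal{J}=\{1,\ldots,J\}$ (customers); positive rationals $r_i$ ($i\in\mathcal{I}$); nonnegative rationals $d^t_j$ ($j\in\mathcal{J},t\in\mathcal{T}$); binary values $a_{ij}$ ($i\in\mathcal{I},j\in\mathcal{J}$). A feasible location policy is $\boldsymbol y\in\{0,1\}^{\mathcal{I}\times\mathcal{T}}$ with $\sum_{i\in\mathcal{I}}y^t_i\le1$ for all $t\in\mathcal{T}$. Define $u^0_j=0$, $c^t_j=u^{t-1}_j+d^t_j$, $u^t_j=\bigl(1-\max_{i\in\mathcal{I}}a_{ij}y^t_i\bigr)c^t_j$ for $t\in\mathcal{T}$. The objective value is $z(\boldsymbol y)=\sum_{t\in\mathcal{T}}\sum_{i\in\mathcal{I}}\sum_{j\in\mathcal{J}}r_ia_{ij}y^t_ic^t_j$, to be maximized. The instance has *identical rewards* if $r_i=R$ for all $i\in\mathcal{I}$, for some constant $R>0$. **Backward Greedy Heuristic.** Start with $y^t_i=0$ fixed for all $i\in\mathcal{I},t\in\mathcal{T}$.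 For $t=T,T-1,\ldots,1$: free the variables $(y^t_i)_{i\in\mathcal{I}}$ of period $t$ only, keeping periods $t+1,\ldots,T$ at their previously chosen values and periods $1,\ldots,t-1$ at zero; choose values for $(y^t_i)_{i\in\mathcal{I}}$ maximizing $z$ over feasible policies under these fixings (ties broken arbitrarily); fix $(y^t_i)_{i\in\mathcal{I}}$ to these values. Return the resulting policy $\boldsymbol y^B$. (Each maximization can be done by inspecting all locations.) *)

(* Defs.v *)
From HB Require Import structures.
From mathcomp Require Import all_boot all_order all_algebra.
Set Implicit Arguments.
Unset Strict Implicit.
Unset Printing Implicit Defensive.
Import Order.TTheory GRing.Theory Num.Theory.
Local Open Scope ring_scope.

(* Periods, locations and customers are numbered from 0: [t : 'I_(nT D)] stands
   for period t + 1. *)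

Record instance := Instance {
  nT : nat;
  nI : nat;
  nJ : nat;
  reward : 'I_nI -> rat;
  demand : 'I_nT -> 'I_nJ -> rat;
  covers : 'I_nI -> 'I_nJ -> bool;
  reward_gt0 : forall i, 0 < reward i;
  demand_ge0 : forall t j, 0 <= demand t j }.

Definition identical_rewards (D : instance) : Prop :=
  exists2 R : rat, 0 < R & forall i : 'I_(nI D), reward i = R.

Definition policy (D : instance) : Type := 'M[bool]_(nT D, nI D).

Definition zero_policy (D : instance) : policy D := const_mx false.

Definition feasible (D : instance) (y : policy D) : bool :=
  [forall t, (\sum_(i < nI D) y t i <= 1)%N].

(* [unmet y j n] is the demand of customer j left over after the first n
   periods; the maximum over an empty set of locations is 0. *)
Fixpoint unmet (D : instance) (y : policy D) (j : 'I_(nJ D)) (n : nat) : rat :=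
  if n is n'.+1 then
    if insub n' is Some t then
      (1 - (\max_(i < nI D) (covers i j * y t i))%N%:R)
        * (unmet y j n' + demand t j)
    else 0
  else 0.

Definition cumulative (D : instance) (y : policy D)
    (t : 'I_(nT D)) (j : 'I_(nJ D)) : rat :=
  unmet y j t + demand t j.

Definition objective (D : instance) (y : policy D) : rat :=
  \sum_(t < nT D) \sum_(i < nI D) \sum_(j < nJ D)
    reward i * (covers i j)%:R * (y t i)%:R * cumulative y t j.

Definition optimum (D : instance) : rat :=
  objective [arg max_(y > zero_policy D | feasible y) objective y]%O.

Definition agree_off (D : instance) (t : 'I_(nT D)) (y w : policy D) : Prop :=
  forall s i, s != t -> w s i = y s i.

Definition best_at (D : instance) (t : 'I_(nT D)) (y y' : policy D) : Prop :=
  [/\ feasible y', agree_off t y y' &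
      forall w, feasible w -> agree_off t y w -> objective w <= objective y'].

(* [backward_greedy n y]: y is a possible current policy, for some way of
   breaking ties, once the periods of index >= n have been fixed.  The periods
   of index < n are then still zero, so that [best_at] indeed optimises period
   t with the later periods as chosen and the earlier ones at zero. *)
Inductive backward_greedy (D : instance) : nat -> policy D -> Prop :=
| BackwardGreedyStart : backward_greedy (nT D) (zero_policy D)
| BackwardGreedyStep (t : 'I_(nT D)) (y y' : policy D) :
    backward_greedy t.+1 y -> best_at t y y' -> backward_greedy t y'.

Definition heuristic_output (D : instance) (y : policy D) : Prop :=
  backward_greedy 0 y.

(* A model of computation with bit cost:
   imperative programs over two-dimensional arrays of rationals, indexed by
   natural numbers built from loop counters.  Every node of an expression costs
   one plus the bit length of its value, so that a Turing machine can simulate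
   a run in time polynomial in its cost and in the length of the input.  Loop
   bounds are evaluated once, on entry, so that every program terminates. *)

Inductive iexp : Type :=
| IVar of nat
| ICst of nat
| IAdd of iexp & iexp
| ISub of iexp & iexp.

Inductive rexp : Type :=
| RGet of nat & iexp & iexp
| RCst of rat
| RAdd of rexp & rexp
| RSub of rexp & rexp
| RMul of rexp & rexp.

(* [Set_ x i j e] is x[i, j] := e, [If e1 e2 c1 c2] tests e1 <= e2, and
   [For v b c] runs c with the counter v = 0, ..., b - 1. *)
Inductive cmd : Type :=
| Skip
| Set_ of nat & iexp & iexp & rexp
| Seq of cmd & cmd
| If of rexp & rexp & cmd & cmd
| For of nat & iexp & cmd.

Definition counters := nat -> nat.
Definition memory := nat -> nat -> nat -> rat.

Definition nbits (n : nat) : nat := (trunc_log 2 n).+1.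

Definition rbits (q : rat) : nat := (nbits `|numq q| + nbits `|denq q|)%N.

Fixpoint ival (s : counters) (e : iexp) : nat :=
  match e with
  | IVar v => s v
  | ICst n => n
  | IAdd e1 e2 => (ival s e1 + ival s e2)%N
  | ISub e1 e2 => (ival s e1 - ival s e2)%N
  end.

Fixpoint icost (s : counters) (e : iexp) : nat :=
  (1 + nbits (ival s e) +
   match e with
   | IVar _ | ICst _ => 0
   | IAdd e1 e2 | ISub e1 e2 => icost s e1 + icost s e2
   end)%N.

Fixpoint rval (s : counters) (m : memory) (e : rexp) : rat :=
  match e with
  | RGet x i j => m x (ival s i) (ival s j)
  | RCst q => q
  | RAdd e1 e2 => rval s m e1 + rval s m e2
  | RSub e1 e2 => rval s m e1 - rval s m e2
  | RMul e1 e2 => rval s m e1 * rval s m e2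
  end.

Fixpoint rcost (s : counters) (m : memory) (e : rexp) : nat :=
  (1 + rbits (rval s m e) +
   match e with
   | RGet _ i j => icost s i + icost s j
   | RCst _ => 0
   | RAdd e1 e2 | RSub e1 e2 | RMul e1 e2 => rcost s m e1 + rcost s m e2
   end)%N.

Definition set_counter (s : counters) (v n : nat) : counters :=
  fun w => if w == v then n else s w.

Definition set_cell (m : memory) (x i j : nat) (q : rat) : memory :=
  fun x' i' j' => if [&& x' == x, i' == i & j' == j] then q else m x' i' j'.

(* The final memory together with the cost of the run. *)
Fixpoint run (c : cmd) (s : counters) (m : memory) : memory * nat :=
  match c with
  | Skip => (m, 1%N)
  | Set_ x i j e =>
      (set_cell m x (ival s i) (ival s j) (rval s m e),
       (1 + icost s i + icost s j + rcost s m e)%N)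
  | Seq c1 c2 =>
      let: (m1, k1) := run c1 s m in
      let: (m2, k2) := run c2 s m1 in
      (m2, (1 + k1 + k2)%N)
  | If e1 e2 c1 c2 =>
      let: (m', k) :=
        if rval s m e1 <= rval s m e2 then run c1 s m else run c2 s m in
      (m', (1 + rcost s m e1 + rcost s m e2 + k)%N)
  | For v b c' =>
      foldl (fun mk n =>
               let: (m', k) := run c' (set_counter s v n) mk.1 in
               (m', (mk.2 + (1 + nbits n) + k)%N))
            (m, (1 + icost s b)%N) (iota 0 (ival s b))
  end.

Definition cell (p q : nat) (f : 'I_p -> 'I_q -> rat) (i j : nat) : rat :=
  if insub i is Some i' then
    if insub j is Some j' then f i' j' else 0
  else 0.

(* Counters 0, 1, 2 hold the dimensions of the instance. *)
Definition input_counters (D : instance) : counters :=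
  fun v => nth 0%N [:: nT D; nI D; nJ D] v.

(* Arrays 0, 1, 2 hold the demands, the coverage and (in column 0) the rewards.
   Array 3 holds arbitrary bits, one for each period and location, which the
   program may consult to break ties. *)
Definition input_memory (D : instance)
    (ties : 'M[bool]_(nT D, nI D)) : memory :=
  fun x => match x with
  | 0 => cell (@demand D)
  | 1 => cell (fun (i : 'I_(nI D)) (j : 'I_(nJ D)) => (covers i j)%:R)
  | 2 => cell (fun (i : 'I_(nI D)) (_ : 'I_1) => reward i)
  | 3 => cell (fun (t : 'I_(nT D)) (i : 'I_(nI D)) => (ties t i)%:R)
  | _ => fun _ _ => 0
  end.

Definition time (D : instance) (P : cmd) (ties : 'M[bool]_(nT D, nI D)) : nat :=
  (run P (input_counters D) (input_memory ties)).2.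

(* The policy is returned in array 4. *)
Definition returns (D : instance) (P : cmd) (ties : 'M[bool]_(nT D, nI D))
    (y : policy D) : Prop :=
  forall (t : 'I_(nT D)) (i : 'I_(nI D)),
    (run P (input_counters D) (input_memory ties)).1 4%N t i = (y t i)%:R.

(* The bit length of an instance; the three index sets are listed explicitly. *)
Definition input_size (D : instance) : nat :=
  (nT D + nI D + nJ D
   + \sum_(i < nI D) rbits (reward i)
   + \sum_(t < nT D) \sum_(j < nJ D) rbits (demand t j)
   + nI D * nJ D)%N.

(* Every run of P returns a possible output of the heuristic, and every possible
   output is returned for some content of the tie-breaking array. *)
Definition implements_heuristic (C : instance -> Prop) (P : cmd) : Prop :=
  forall D : instance, C D ->
    (forall ties, exists2 y : policy D, returns P ties y & heuristic_output y)
    /\ (forall y : policy D, heuristic_output y -> exists ties, returns P ties y).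

Definition runs_in_polynomial_time (C : instance -> Prop) (P : cmd) : Prop :=
  exists p : {poly nat}, forall D : instance, C D ->
    forall ties : 'M[bool]_(nT D, nI D), (time P ties <= p.[input_size D])%N.

(* Main.v *)
Require Import Defs.
From mathcomp Require Import all_boot all_order all_algebra.
From mathcomp Require Import ring zify.
Set Implicit Arguments.
Unset Strict Implicit.
Unset Printing Implicit Defensive.
Import Order.TTheory GRing.Theory Num.Theory.
Local Open Scope ring_scope.

(** Unserved demand accumulates, so the demand of customer [j] in period [t] is
    captured exactly when some period [s >= t] opens a location covering [j]
    ([captured_from]).  With identical rewards the objective is therefore, up to
    the factor [R], the total weight of the pairs (period, customer) reached in
    this sense ([objectiveE]): a monotone coverage function, maximised under the
    constraint of at most one location per period.  Greedy choice, one period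
    after the other, loses at most a factor 2 on such functions.  Treating the
    periods backwards makes the gain of a choice explicit: opening [i] in period
    [t] adds all the demand up to period [t] of the customers covered by [i] and
    by no later period ([objective_step]).  The heuristic output [y] is worth
    the sum of its gains ([backward_greedyP]).  A pair reached by an optimal
    policy [w] but not by [y] contributes to the gain that a row of [w] would
    have had in the place of the row of [y], and this gain is at most that of
    [y] in the same period; summing, [w] is worth at most twice [y]
    ([greedy_approx]).

    For the running time, the heuristic is written as a program that only adds,
    subtracts and compares.  Any such program runs in polynomial time
    ([additive_polynomial_time]): its loop bounds are polynomial in the
    dimensions, a common denominator of the input remains one of the whole
    memory, and every step lengthens the numbers by a bounded number of bits.

    The program keeps prefix sums of the demands and a flag for each customer
    covered by a period already fixed, which together give the gain of every
    location; it retains the best location, or none if no gain is positive and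
    no tie bit asks for one.  It thus follows the heuristic for all tie bits,
    and it returns a prescribed output of the heuristic when this output is
    itself used as the tie bits ([greedy_program_output]). *)

(** * The objective as a coverage function, and the factor 2 *)

Section AtMostOne.
Variables (n : nat) (a b : 'I_n -> bool).

Lemma at_most_one_cases : (\sum_(i < n) b i <= 1)%N ->
  (b =1 xpred0) \/ (exists i0, b =1 pred1 i0).
Proof.
move=> le1; have [/existsP[i0 bi0]|/existsPn b0] := boolP [exists i, b i].
  right; exists i0 => i /=; have [->//|ne] := eqVneq i i0.
  apply: contraTF le1 => bi.
  by rewrite (bigD1 i0) //= (bigD1 i) //= bi bi0 -ltnNge addnA leq_addr.
by left=> i; apply/negbTE.
Qed.

Lemma at_most_one_sum (x : 'I_n -> rat) :
  (b =1 xpred0) \/ (exists i0, b =1 pred1 i0) ->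
  \sum_i (b i)%:R * x i = if [pick i | b i] is Some i then x i else 0.
Proof.
case=> [b0|[i0 bE]].
  case: pickP => [i|_]; first by rewrite b0.
  by rewrite big1 // => i _; rewrite b0 mul0r.
case: pickP => [i|/(_ i0)]; last by rewrite bE /= eqxx.
rewrite bE /= => /eqP ->; rewrite (bigD1 i0) //= bE /= eqxx mul1r big1 ?addr0 //.
by move=> k /negbTE ne; rewrite bE /= ne mul0r.
Qed.

Lemma sum_at_most_one : (\sum_(i < n) b i <= 1)%N ->
  \sum_i (b i)%:R * (a i)%:R = [exists i, a i && b i]%:R :> rat.
Proof.
move=> /at_most_one_cases bP; rewrite (at_most_one_sum _ bP).
case: pickP => [i bi|b0]; last first.
  by case: existsP => // -[i]; rewrite b0 andbF.
case: existsP => [[k /andP[ak bk]]|nex].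
  case: bP => [b0|[i0 bE]]; first by rewrite b0 in bi.
  by move: bi bk; rewrite !bE /= => /eqP -> /eqP <-; rewrite ak.
by case ai: (a i) => //; case: nex; exists i; rewrite ai.
Qed.

End AtMostOne.

Lemma bigmax_exists n (a b : 'I_n -> bool) :
  \max_(i < n) (a i * b i)%N = [exists i, a i && b i] :> nat.
Proof.
case: existsP => [[i /andP[ai bi]]|nex]; last first.
  apply/eqP; rewrite eqn_leq leq0n andbT; apply/bigmax_leqP => i _.
  rewrite mulnb; case ab: (_ && _) => //; case: nex; exists i; exact: ab.
apply/eqP; rewrite eqn_leq; apply/andP; split.
  by apply/bigmax_leqP => k _; rewrite mulnb leq_b1.
by apply: leq_trans (leq_bigmax i); rewrite ai bi.
Qed.

Section Coverage.
Variable D : instance.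
Implicit Types (y w : policy D) (t s : 'I_(nT D)) (i : 'I_(nI D)) (j : 'I_(nJ D)).

Definition covered y t j : bool := [exists i, covers i j && y t i].

(** Demand of customer [j] arising in period [n] is eventually captured exactly
    when some period from [n] on covers [j], because unserved demand
    accumulates.  Hence, up to the reward, the objective is a weighted coverage
    function of this predicate. *)
Definition reached y (n : nat) j : bool :=
  [exists s : 'I_(nT D), (n <= s)%N && covered y s j].

Definition prefix_demand (n : nat) j : rat :=
  \sum_(t < nT D | (t < n)%N) demand t j.

(** The marginal value, per unit of reward, of opening [i] in period [t] when
    the later periods are as in [y] and the earlier ones are empty: a customer
    served later would have been captured anyway. *)
Definition gain y t i : rat :=
  \sum_j (covers i j && ~~ reached y t.+1 j)%:R * prefix_demand t.+1 j.

Definition row_gain y w t : rat := \sum_i (w t i)%:R * gain y t i.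

Lemma sum_from (F : 'I_(nT D) -> rat) t :
  \sum_(s < nT D | (t <= s)%N) F s = F t + \sum_(s < nT D | (t < s)%N) F s.
Proof.
rewrite (bigD1 t) //=; congr (_ + _); apply: eq_bigl => s.
by rewrite ltn_neqAle andbC eq_sym.
Qed.

Lemma reached_rec y t j : reached y t j = covered y t j || reached y t.+1 j.
Proof.
apply/existsP/orP => [[s /andP[]]|[c|/existsP[s /andP[lt c]]]].
- rewrite leq_eqVlt => /orP[/eqP/val_inj-> c|lt c]; first by left.
  by right; apply/existsP; exists s; rewrite lt.
- by exists t; rewrite leqnn.
- by exists s; rewrite c ltnW.
Qed.

Lemma reached_end y j : reached y (nT D) j = false.
Proof. by apply/existsP => -[s]; rewrite leqNgt ltn_ord. Qed.

Lemma reached_mono y m n j : (m <= n)%N -> reached y n j -> reached y m j.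
Proof.
move=> le /existsP[s /andP[ns c]]; apply/existsP; exists s.
by rewrite c (leq_trans le).
Qed.

Lemma eq_covered y w t j : (forall i, y t i = w t i) -> covered y t j = covered w t j.
Proof. by move=> E; apply: eq_existsb => i; rewrite E. Qed.

Lemma eq_reached y w n j :
  (forall s i, (n <= s)%N -> y s i = w s i) -> reached y n j = reached w n j.
Proof.
move=> E; apply: eq_existsb => s; case: leqP => //= ns.
by apply: eq_covered => i; rewrite E.
Qed.

Lemma eq_gain y w t i :
  (forall s i, (t < s)%N -> y s i = w s i) -> gain y t i = gain w t i.
Proof. by move=> E; apply: eq_bigr => j _; rewrite (eq_reached _ E). Qed.

Lemma prefix_demand_ge0 n j : 0 <= prefix_demand n j.
Proof. by apply: sumr_ge0 => t _; apply: demand_ge0. Qed.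

Lemma gain_ge0 y t i : 0 <= gain y t i.
Proof. by apply: sumr_ge0 => j _; rewrite mulr_ge0 ?prefix_demand_ge0. Qed.

Lemma feasible_row y t : feasible y -> (\sum_(i < nI D) y t i <= 1)%N.
Proof. by move/forallP. Qed.

Lemma row_gainE y w t : feasible w ->
  row_gain y w t =
  \sum_j (covered w t j && ~~ reached y t.+1 j)%:R * prefix_demand t.+1 j.
Proof.
move=> fw; rewrite /row_gain /gain; under eq_bigr do rewrite mulr_sumr.
rewrite exchange_big /=; apply: eq_bigr => j _.
under eq_bigr do rewrite mulrA; rewrite -mulr_suml; congr (_ * _).
rewrite (sum_at_most_one (fun i => covers i j && ~~ reached y t.+1 j)
          (feasible_row t fw)).
congr (_%:R); congr nat_of_bool; rewrite /covered.
case: (reached y t.+1 j) => /=; rewrite ?andbF ?andbT.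
  by apply/existsP => -[i]; rewrite andbF.
by apply: eq_existsb => i; rewrite andbT.
Qed.

Lemma row_gain_le y w t (g : rat) : feasible w -> 0 <= g ->
  (forall i, gain y t i <= g) -> row_gain y w t <= g.
Proof.
move=> /(feasible_row t)/at_most_one_cases wP g0 le.
by rewrite /row_gain (at_most_one_sum _ wP); case: pickP.
Qed.

Lemma unmetS y j t :
  unmet y j t.+1 = (1 - (covered y t j)%:R) * cumulative y t j.
Proof. by rewrite /= valK bigmax_exists. Qed.

(** By downward induction on [n]: what is left over at [n] is captured in full
    if the customer is covered at [n] or later, and is lost otherwise. *)
Lemma captured_from y j n k : (n + k = nT D)%N ->
  \sum_(t < nT D | (n <= t)%N) (covered y t j)%:R * cumulative y t j
  = (reached y n j)%:R * unmet y j n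
    + \sum_(t < nT D | (n <= t)%N) (reached y t j)%:R * demand t j.
Proof.
elim: k n => [|k IH] n.
  rewrite addn0 => ->; rewrite reached_end mul0r add0r !big1 // => t;
    by rewrite leqNgt ltn_ord.
move=> e; have lt : (n < nT D)%N by lia.
pose t := Ordinal lt; rewrite -[n]/(nat_of_ord t) !sum_from.
rewrite IH ?addSnnS // unmetS (reached_rec y t) /cumulative.
by case: (covered y t j); case: (reached y t.+1 j) => /=; ring.
Qed.

(** The coverage form of the objective, on which all later arguments rest. *)
Lemma objectiveE (R : rat) y : (forall i, reward i = R) -> feasible y ->
  objective y = R * \sum_j \sum_(t < nT D) (reached y t j)%:R * demand t j.
Proof.
move=> rE fy; transitivity
  (R * \sum_j \sum_(t < nT D) (covered y t j)%:R * cumulative y t j).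
  rewrite mulr_sumr /objective; under [RHS]eq_bigr do rewrite mulr_sumr.
  rewrite [RHS]exchange_big /=; apply: eq_bigr => t _.
  rewrite exchange_big /=; apply: eq_bigr => j _.
  rewrite -(sum_at_most_one (fun i => covers i j) (feasible_row t fy)).
  rewrite mulr_suml mulr_sumr; apply: eq_bigr => i _; rewrite rE; ring.
congr (_ * _); apply: eq_bigr => j _.
by have := @captured_from y j 0 (nT D) erefl; rewrite mulr0 add0r.
Qed.

(** As the rows up to [t] of [y] are empty, a demand of a period [s <= t] is
    reached by [w] and not by [y] exactly when its customer is covered by [w] in
    period [t] and by no later period. *)
Lemma objective_step (R : rat) t y w : (forall i, reward i = R) ->
  feasible y -> feasible w -> agree_off t y w ->
  (forall s i, (s <= t)%N -> y s i = false) ->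
  objective w = objective y + R * row_gain y w t.
Proof.
move=> rE fy fw agr y0; rewrite !(objectiveE rE) // row_gainE // -mulrDr.
congr (_ * _); rewrite -big_split /=; apply: eq_bigr => j _.
rewrite mulr_sumr [X in _ + X]big_mkcond -big_split /=; apply: eq_bigr => s _.
have wE n : (t < n)%N -> reached w n j = reached y n j.
  move=> lt; apply: eq_reached => s' i le; apply: agr; apply/eqP => e.
  by move: lt; rewrite -e ltnNge le.
rewrite ltnS; case: leqP => le; last by rewrite wE // addr0.
(* with empty rows before t, being reached from s or from t is the same *)
have low (v : policy D) : (forall s i, (s < t)%N -> v s i = false) ->
    reached v s j = reached v t j.
  move=> v0; apply/idP/idP; last exact: reached_mono.
  move=> /existsP[s' /andP[_ c]]; apply/existsP; exists s'; rewrite c andbT.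
  by rewrite leqNgt; apply/negP => lt; case/existsP: c => i; rewrite v0 // andbF.
rewrite !low; first last.
- move=> s' i lt; rewrite agr ?y0 ?(ltnW lt) //.
  by apply/eqP => e; rewrite e ltnn in lt.
- by move=> s' i lt; rewrite y0 // ltnW.
rewrite !reached_rec wE // (_ : covered y t j = false) /=; last first.
  by apply/existsP => -[i]; rewrite y0 // andbF.
by case: (covered w t j); case: (reached y t.+1 j) => /=; ring.
Qed.

Definition greedy_row y t : Prop := forall i, gain y t i <= row_gain y y t.

Definition with_row y t (r : 'I_(nI D) -> bool) : policy D :=
  \matrix_(s, i) if s == t then r i else y s i.

Lemma with_row_agree y t r : agree_off t y (with_row y t r).
Proof. by move=> s i /negbTE ne; rewrite mxE ne. Qed.

Lemma with_row_feasible y t (r : 'I_(nI D) -> bool) : feasible y ->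
  (\sum_(i < nI D) r i <= 1)%N -> feasible (with_row y t r).
Proof.
move=> /forallP fy fr; apply/forallP => s.
under eq_bigr do rewrite mxE; case: eqP => // _; exact: fy.
Qed.

Lemma agree_off_above t y w : agree_off t y w ->
  forall s i, (t < s)%N -> w s i = y s i.
Proof. by move=> agr s i lt; apply: agr; apply/eqP => e; rewrite e ltnn in lt. Qed.

Lemma agree_off_reached t y w j : agree_off t y w ->
  reached w t.+1 j = reached y t.+1 j.
Proof. by move=> /agree_off_above agr; apply: eq_reached. Qed.

Lemma agree_off_gain t y w i : agree_off t y w -> gain w t i = gain y t i.
Proof. by move=> /agree_off_above agr; apply: eq_gain. Qed.

(** The choice of period [t] adds [R * row_gain] to an objective that it does
    not otherwise affect, so it is optimal when its gain beats that of each
    single location. *)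
Lemma best_atP (R : rat) t y w : 0 < R -> (forall i, reward i = R) ->
  feasible y -> (forall s i, (s <= t)%N -> y s i = false) ->
  best_at t y w <-> [/\ feasible w, agree_off t y w & greedy_row w t].
Proof.
move=> R0 rE fy y0.
have objE v : feasible v -> agree_off t y v ->
    objective v = objective y + R * row_gain v v t.
  move=> fv agr; rewrite (objective_step rE fy fv agr) //.
  by congr (_ + _ * _); apply: eq_bigr => i _; rewrite (agree_off_gain _ agr).
split=> -[fw agr best]; split=> //.
  move=> i; pose v := with_row y t (pred1 i).
  have fv : feasible v.
    by apply: with_row_feasible => //; rewrite (bigD1 i) //= eqxx big1 // => k /negbTE ->.
  have agrv : agree_off t y v by apply: with_row_agree.
  have := best v fv agrv; rewrite (objE v) // (objE w) // lerD2l ler_pM2l //.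
  apply: le_trans; rewrite /row_gain (bigD1 i) //= mxE eqxx /= eqxx mul1r big1 ?addr0.
    by rewrite (agree_off_gain _ agr) (agree_off_gain _ agrv).
  by move=> k /negbTE ne; rewrite mxE eqxx /= ne mul0r.
move=> v fv agrv; rewrite (objE v) // (objE w) // lerD2l ler_pM2l //.
apply: row_gain_le => // [|i].
  by apply: sumr_ge0 => i _; rewrite mulr_ge0 ?gain_ge0.
by rewrite (agree_off_gain _ agrv) -(agree_off_gain _ agr).
Qed.

Lemma zero_feasible : feasible (zero_policy D).
Proof. by apply/forallP => t; rewrite big1 // => i _; rewrite mxE. Qed.

Lemma eq_greedy_row y w t : (forall s i, (t <= s)%N -> y s i = w s i) ->
  greedy_row y t -> greedy_row w t.
Proof.
move=> E g i; have gE k : gain w t k = gain y t k.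
  by apply: eq_gain => s k' lt; rewrite E // ltnW.
rewrite gE /row_gain; apply: le_trans (g i) _; apply: ler_sum => k _.
by rewrite gE E.
Qed.

(** All that is used of a run of the heuristic: every row fixed so far is greedy
    with respect to the final policy, and the objective telescopes into the sum
    of the gains, since a gain depends on later rows only. *)
Lemma backward_greedyP (R : rat) n y : 0 < R -> (forall i, reward i = R) ->
  backward_greedy n y ->
  [/\ feasible y, (forall s i, (s < n)%N -> y s i = false),
      (forall s : 'I_(nT D), (n <= s)%N -> greedy_row y s) &
      objective y = R * \sum_(s < nT D | (n <= s)%N) row_gain y y s].
Proof.
move=> R0 rE; elim=> [|t {}y w _ [fy y0 gr obj] /(best_atP w R0 rE fy) []].
- split; [exact: zero_feasible| by move=> *; rewrite mxE | |].
  + by move=> s; rewrite leqNgt ltn_ord.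
  + rewrite big1 => [|s]; last by rewrite leqNgt ltn_ord.
    rewrite mulr0 /objective big1 // => t _; rewrite big1 // => i _.
    by rewrite big1 // => j _; rewrite mxE mulr0 mul0r.
- by move=> s i le; apply: y0.
move=> fw agr grw; have up := agree_off_above agr; split=> //.
- move=> s i lt; rewrite agr ?y0 ?ltnS ?(ltnW lt) //.
  by apply/eqP => e; rewrite e ltnn in lt.
- move=> s; rewrite leq_eqVlt => /orP[/eqP/val_inj<-//|lt].
  apply: eq_greedy_row (gr s lt) => s' i le.
  by rewrite up // (leq_trans lt).
rewrite (objective_step rE fy fw agr) // obj sum_from mulrDr addrC.
congr (_ * _ + _ * _).
  by apply: eq_bigr => i _; rewrite (agree_off_gain _ agr).
apply: eq_bigr => s lt; apply: eq_bigr => i _; rewrite up //.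
congr (_ * _); apply: eq_gain => s' k lt'.
by rewrite up // (ltn_trans lt).
Qed.

(** Each demand that the optimal [w] captures is either captured by [y] too, or
    is covered by [w] in some period [s] after which [y] never covers its
    customer; it then counts in the gain of the row of [w] at [s].  The demands
    of the first kind are worth at most the objective of [y], and so are those
    of the second kind, because each row of [y] gains at least as much as the
    row of [w]. *)
Theorem greedy_approx (R : rat) y : 0 < R -> (forall i, reward i = R) ->
  heuristic_output y -> optimum D <= 2 * objective y.
Proof.
move=> R0 rE /(backward_greedyP R0 rE)[fy _ gr obj].
rewrite /optimum; case: arg_maxP; first exact: zero_feasible.
move=> w fw _.
have -> : 2 * objective y = objective y + objective y by ring.
rewrite {2}obj !(objectiveE rE) // -mulrDr ler_pM2l //.
have {}gr s : row_gain y w s <= row_gain y y s.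
  apply: row_gain_le => // [|i]; last exact: gr.
  by apply: sumr_ge0 => i _; rewrite mulr_ge0 ?gain_ge0.
apply: (@le_trans _ _ (\sum_j \sum_(t < nT D) (reached y t j)%:R * demand t j
                       + \sum_(s < nT D) row_gain y w s)); last first.
  by rewrite lerD2l; apply: ler_sum => s _.
under [X in _ + X]eq_bigr do rewrite row_gainE //.
rewrite [X in _ + X]exchange_big -big_split /=; apply: ler_sum => j _.
under [X in _ + X]eq_bigr do rewrite /prefix_demand mulr_sumr big_mkcond.
rewrite [X in _ + X]exchange_big -big_split /=; apply: ler_sum => t _.
have [rw|_] := boolP (reached w t j); last first.
  rewrite mul0r addr_ge0 ?mulr_ge0 ?demand_ge0 //; apply: sumr_ge0 => s _.
  by case: ifP => // _; rewrite mulr_ge0 ?demand_ge0.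
have pos s : 0 <= if (t < s.+1)%N then
   (covered w s j && ~~ reached y s.+1 j)%:R * demand t j else 0.
  by case: ifP => // _; rewrite mulr_ge0 ?demand_ge0.
have [ry|nry] := boolP (reached y t j); first by rewrite lerDl sumr_ge0.
have /existsP[s /andP[le c]] := rw.
rewrite mul0r add0r (bigD1 s) //= ltnS le c.
have -> : reached y s.+1 j = false.
  by apply: contraNF nry; apply: reached_mono; rewrite leqW.
by rewrite lerDl sumr_ge0.
Qed.

End Coverage.

(** * Programs without multiplication run in polynomial time *)

Lemma foldl_iota_ind (T : Type) (Inv : nat -> T -> Prop) (f : T -> nat -> T)
    (x : T) (n : nat) :
  Inv 0%N x -> (forall k y, (k < n)%N -> Inv k y -> Inv k.+1 (f y k)) ->
  Inv n (foldl f x (iota 0 n)).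
Proof.
move=> I0; elim: n => [_ //|n IH step].
rewrite -addn1 iotaD foldl_cat /= add0n addn1; apply: (step) => //.
by apply: IH => k y lt; apply: step; rewrite ltnW.
Qed.

(** Evaluation with value of type [nat] on the nose, so that the arithmetic
    tactics see a natural number rather than an element of a semiring. *)
Definition polyval (p : {poly nat}) (n : nat) : nat := p.[n].

Lemma polyvalD p q n : polyval (p + q) n = (polyval p n + polyval q n)%N.
Proof. exact: hornerD. Qed.

Lemma polyvalM p q n : polyval (p * q) n = (polyval p n * polyval q n)%N.
Proof. exact: hornerM. Qed.

Lemma polyvalC c n : polyval c%:P n = c.
Proof. exact: hornerC. Qed.

Lemma polyvalX n : polyval 'X n = n.
Proof. exact: hornerX. Qed.

Lemma polyval_comp p q n : polyval (p \Po q) n = polyval p (polyval q n).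
Proof. exact: horner_comp. Qed.

Definition polyvalE := (polyvalD, polyvalM, polyvalC, polyvalX, polyval_comp).

Lemma leq_polyval p m n : (m <= n)%N -> (polyval p m <= polyval p n)%N.
Proof.
move=> le; elim/poly_ind: p => [|p c IH]; first by rewrite /polyval !horner0.
by rewrite !polyvalE leq_add2r leq_mul.
Qed.

Lemma nbits_le n k : (n <= 2 ^ k)%N -> (nbits n <= k.+1)%N.
Proof.
by move=> le; rewrite /nbits ltnS -[k](@trunc_expnK 2) ?leq_trunc_log.
Qed.

Lemma ltn_nbits n : (n < 2 ^ nbits n)%N.
Proof. exact: trunc_log_ltn. Qed.

Lemma nbits_leS n : (nbits n <= n.+1)%N.
Proof. by apply: nbits_le; rewrite ltnW // ltn_expl. Qed.

(** Without multiplication an assignment enlarges the magnitudes by a factor that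
    depends on its expression only, and with integer constants it keeps any
    common denominator of the memory.  With multiplication, repeated squaring
    would make the bit length exponential in the number of steps. *)
Fixpoint additive_exp (e : rexp) : bool :=
  match e with
  | RGet _ _ _ => true
  | RCst q => q \is a Num.int
  | RAdd e1 e2 | RSub e1 e2 => additive_exp e1 && additive_exp e2
  | RMul _ _ => false
  end.

Fixpoint additive_cmd (c : cmd) : bool :=
  match c with
  | Skip => true
  | Set_ _ _ _ e => additive_exp e
  | Seq c1 c2 => additive_cmd c1 && additive_cmd c2
  | If e1 e2 c1 c2 =>
      [&& additive_exp e1, additive_exp e2, additive_cmd c1 & additive_cmd c2]
  | For _ _ c1 => additive_cmd c1
  end.

(** The number of bits by which evaluating an expression can exceed the
    magnitudes held in memory. *)
Fixpoint growth (e : rexp) : nat :=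
  match e with
  | RGet _ _ _ => 0
  | RCst q => rbits q
  | RAdd e1 e2 | RSub e1 e2 | RMul e1 e2 => (growth e1 + growth e2).+1
  end.

Definition below (n : nat) (s : counters) : Prop := forall v, (s v <= n)%N.

Lemma below_set n k s v : below n s -> (k <= n)%N -> below n (set_counter s v k).
Proof. by move=> sn kn w; rewrite /set_counter; case: ifP. Qed.

Lemma below_le n k s : below n s -> (n <= k)%N -> below k s.
Proof. by move=> sn nk v; apply: leq_trans nk. Qed.

Lemma ival_poly e : exists p : {poly nat},
  forall s n, below n s -> (ival s e <= polyval p n)%N.
Proof.
elim: e => [v|k|e1 [p1 h1] e2 [p2 h2]|e1 [p1 h1] e2 _] /=.
- by exists 'X => s n sn; rewrite polyvalX.
- by exists k%:P => s n sn; rewrite polyvalC.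
- by exists (p1 + p2) => s n sn; rewrite polyvalE leq_add ?h1 ?h2.
- by exists p1 => s n sn; apply: leq_trans (leq_subr _ _) (h1 s n sn).
Qed.

Lemma icost_poly e : exists p : {poly nat},
  forall s n, below n s -> (icost s e <= polyval p n)%N.
Proof.
have leaf e' : exists p : {poly nat}, forall s n, below n s ->
    (1 + nbits (ival s e') <= polyval p n)%N.
  have [p h] := ival_poly e'; exists (p + 2%N%:P) => s n sn; rewrite !polyvalE.
  by have := h s n sn; have := nbits_leS (ival s e'); lia.
elim: e => [v|k|e1 [p1 h1] e2 [p2 h2]|e1 [p1 h1] e2 [p2 h2]].
- by have [p h] := leaf (IVar v); exists p => s n /h /=; rewrite addn0.
- by have [p h] := leaf (ICst k); exists p => s n /h /=; rewrite addn0.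
- have [p h] := leaf (IAdd e1 e2); exists (p + p1 + p2) => s n sn.
  have := h s n sn; have := h1 s n sn; have := h2 s n sn.
  by rewrite !polyvalE /=; lia.
- have [p h] := leaf (ISub e1 e2); exists (p + p1 + p2) => s n sn.
  have := h s n sn; have := h1 s n sn; have := h2 s n sn.
  by rewrite !polyvalE /=; lia.
Qed.

Section FixedDenominator.
Variable Q : nat.
Hypothesis Q_gt0 : (0 < Q)%N.

(** [Q] is a common denominator; it stays the same during a whole run, while the
    bound [b] on the bits of the magnitude grows. *)
Definition small (b : nat) (q : rat) : Prop :=
  q * Q%:R \is a Num.int /\ `|q| <= 2 ^+ b.

Definition small_memory (b : nat) (m : memory) : Prop :=
  forall x i j, small b (m x i j).

Lemma small_le b b' q : (b <= b')%N -> small b q -> small b' q.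
Proof. by move=> le [qQ qb]; split=> //; apply: le_trans qb _; rewrite ler_weXn2l. Qed.

Lemma norm_le_nbits (q : rat) : `|q| <= 2 ^+ (nbits `|numq q|).
Proof.
rewrite -[q in `|q|]divq_num_den normrM normfV.
apply: (@le_trans _ _ `|(numq q)%:~R|).
  rewrite ler_piMr // invf_le1 ?normr_gt0 ?intr_eq0 ?denq_neq0 //.
  by rewrite -intr_norm ler1z -gtz0_ge1 normr_gt0 denq_neq0.
rewrite -intr_norm -abszE -pmulrn -natrX ler_nat ltnW //; exact: ltn_nbits.
Qed.

Lemma norm_le_rbits (q : rat) : `|q| <= 2 ^+ rbits q.
Proof.
apply: le_trans (norm_le_nbits q) _.
by rewrite ler_weXn2l // leq_addr.
Qed.

(** The denominator of [q] divides [Q], and its numerator is [`|q|] times its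
    denominator. *)
Lemma small_rbits b q : small b q -> (rbits q <= b + 2 * nbits Q + 2)%N.
Proof.
move=> [/intrP[z zE] qb].
have dQ : (`|denq q| <= Q)%N.
  have zE' : numq q * Q%:Z = z * denq q.
    by apply: (@intr_inj rat); rewrite !intrM -zE numqE -pmulrn mulrAC.
  have : (denq q %| numq q * Q%:Z)%Z by rewrite zE' dvdz_mull.
  rewrite Gauss_dvdzr; last by rewrite coprimezE coprime_sym coprime_num_den.
  by rewrite dvdzE => /dvdn_leq ->.
have den : (nbits `|denq q| <= nbits Q)%N.
  by rewrite ltnS leq_trunc_log.
have num : (nbits `|numq q| <= (b + nbits Q).+1)%N.
  apply: nbits_le; rewrite expnD -(ler_nat rat) natrM natrX.
  have -> : (`|numq q|%N)%:R = `|q| * `|denq q|%N%:R :> rat.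
    by rewrite !pmulrn !abszE !intr_norm -normrM -numqE.
  apply: ler_pM => //; rewrite ler_nat; apply: leq_trans dQ _.
  exact/ltnW/ltn_nbits.
by rewrite /rbits; lia.
Qed.

Lemma small_opp b q : small b q -> small b (- q).
Proof. by case=> qQ qb; split; rewrite ?mulNr ?rpredN ?normrN. Qed.

Lemma small_add b c d p q : small (b + c) p -> small (b + d) q ->
  small (b + (c + d).+1) (p + q).
Proof.
move=> [pQ pb] [qQ qb]; split; first by rewrite mulrDl rpredD.
apply: le_trans (ler_normD _ _) _.
rewrite addnS exprS mulr_natl mulr2n; apply: lerD.
  by apply: le_trans pb _; rewrite ler_weXn2l // addnA leq_addr.
by apply: le_trans qb _; rewrite ler_weXn2l // (addnC c) addnA leq_addr.
Qed.

Lemma rval_small s m b e : additive_exp e -> small_memory b m ->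
  small (b + growth e) (rval s m e).
Proof.
move=> + sm; elim: e => [x i j _|q qZ|e1 IH1 e2 IH2|e1 IH1 e2 IH2|//] /=.
- by rewrite addn0; apply: sm.
- split; first by rewrite rpredM ?rpred_nat.
  apply: le_trans (norm_le_rbits q) _.
  by rewrite ler_weXn2l // leq_addl.
- by move=> /andP[/IH1 h1 /IH2 h2]; apply: small_add.
- by move=> /andP[/IH1 h1 /IH2 h2]; apply/small_add/small_opp.
Qed.

End FixedDenominator.

Lemma rcost_poly e : additive_exp e -> exists p : {poly nat},
  forall Q s m n b, (0 < Q)%N -> below n s -> small_memory Q b m ->
    (rcost s m e <= polyval p (n + b + nbits Q))%N.
Proof.
have leaf e' : additive_exp e' -> exists p : {poly nat},
    forall Q s m n b, (0 < Q)%N -> below n s -> small_memory Q b m ->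
    (1 + rbits (rval s m e') <= polyval p (n + b + nbits Q))%N.
  move=> ae; exists ('X + 'X + (growth e' + 3)%N%:P) => Q s m n b Q0 sn sm.
  have := small_rbits Q0 (rval_small s ae sm); rewrite !polyvalE; lia.
elim: e => [x i j|q|e1 IH1 e2 IH2|e1 IH1 e2 IH2|//] ae;
    have [p h] := leaf _ ae.
- have [[p1 h1] [p2 h2]] := (icost_poly i, icost_poly j).
  exists (p + p1 + p2) => Q s m n b Q0 sn sm.
  have := h Q s m n b Q0 sn sm; have := h1 s _ sn; have := h2 s _ sn.
  have le : (n <= n + b + nbits Q)%N by lia.
  have := leq_polyval p1 le; have := leq_polyval p2 le.
  by rewrite !polyvalE /=; lia.
- exists p => Q s m n b Q0 sn sm; rewrite /= addn0; exact: (h Q s m n b).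
- move: ae => /= /andP[/IH1[p1 h1] /IH2[p2 h2]].
  exists (p + p1 + p2) => Q s m n b Q0 sn sm.
  have := h Q s m n b Q0 sn sm; have := h1 Q s m n b Q0 sn sm.
  by have := h2 Q s m n b Q0 sn sm; rewrite !polyvalE /=; lia.
- move: ae => /= /andP[/IH1[p1 h1] /IH2[p2 h2]].
  exists (p + p1 + p2) => Q s m n b Q0 sn sm.
  have := h Q s m n b Q0 sn sm; have := h1 Q s m n b Q0 sn sm.
  by have := h2 Q s m n b Q0 sn sm; rewrite !polyvalE /=; lia.
Qed.

Lemma small_memory_le Q b b' m : (b <= b')%N ->
  small_memory Q b m -> small_memory Q b' m.
Proof. by move=> le sm x i j; apply: small_le le (sm x i j). Qed.

(** The number of iterations of a loop is polynomial in the bound [n] on the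
    counters, so the magnitudes gain polynomially many bits in total; the
    polynomial [g] for this growth depends on [n] only, which is what lets the
    bounds for successive iterations add up instead of compounding. *)
Lemma run_poly c : additive_cmd c -> exists p g : {poly nat},
  forall Q s m n b, (0 < Q)%N -> below n s -> small_memory Q b m ->
    small_memory Q (b + polyval g n)%N (run c s m).1
    /\ ((run c s m).2 <= polyval p (n + b + nbits Q))%N.
Proof.
elim: c => [|x i j e|c1 IH1 c2 IH2|e1 e2 c1 IH1 c2 IH2|v e c IH] /=.
- move=> _; exists 1%N%:P, 0%N%:P => Q s m n b Q0 sn sm.
  by rewrite !polyvalC addn0.
- move=> ae; have [p h] := rcost_poly ae.
  have [[p1 h1] [p2 h2]] := (icost_poly i, icost_poly j).
  exists (1%N%:P + p1 + p2 + p), (growth e)%:P => Q s m n b Q0 sn sm; split.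
    move=> x' i' j'; rewrite polyvalC /set_cell; case: ifP => _.
      exact: rval_small.
    by apply: small_le (sm x' i' j'); rewrite leq_addr.
  have le : (n <= n + b + nbits Q)%N by lia.
  have := leq_polyval p1 le; have := leq_polyval p2 le.
  have := h Q s m n b Q0 sn sm; have := h1 s n sn; have := h2 s n sn.
  by rewrite !polyvalE; lia.
- move=> /andP[/IH1[p1 [g1 h1]] /IH2[p2 [g2 h2]]].
  exists (1%N%:P + p1 + (p2 \Po ('X + g1))), (g1 + g2) => Q s m n b Q0 sn sm.
  have := h1 Q s m n b Q0 sn sm; case: (run c1 s m) => m1 k1 /= [sm1 k1le].
  have := h2 Q s m1 n _ Q0 sn sm1; case: (run c2 s m1) => m2 k2 /= [sm2 k2le].
  rewrite !polyvalE addnA; split=> //.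
  have le : (n <= n + b + nbits Q)%N by lia.
  have := leq_polyval g1 le => le1.
  have le2 : (n + (b + polyval g1 n) + nbits Q <=
              n + b + nbits Q + polyval g1 (n + b + nbits Q))%N by lia.
  by have := leq_polyval p2 le2; lia.
- move=> /and4P[/rcost_poly[q1 r1] /rcost_poly[q2 r2]].
  move=> /IH1[p1 [g1 h1]] /IH2[p2 [g2 h2]].
  exists (1%N%:P + q1 + q2 + p1 + p2), (g1 + g2) => Q s m n b Q0 sn sm.
  have := r1 Q s m n b Q0 sn sm; have := r2 Q s m n b Q0 sn sm.
  rewrite !polyvalE; case: ifP => _.
    have := h1 Q s m n b Q0 sn sm; case: (run c1 s m) => m1 k1 /= [sm1 k1le].
    by split; [apply: small_memory_le sm1; lia | lia].
  have := h2 Q s m n b Q0 sn sm; case: (run c2 s m) => m1 k1 /= [sm1 k1le].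
  by split; [apply: small_memory_le sm1; lia | lia].
- move=> /IH[p [g h]]; have [[q r] [q' r']] := (ival_poly e, icost_poly e).
  pose G := g \Po ('X + q); pose C := p \Po ('X + q + q * G).
  exists (1%N%:P + q' + q * (2%N%:P + q + C)), (q * G) => Q s m n b Q0 sn sm.
  set N := (n + b + nbits Q)%N.
  have NE : N = (n + b + nbits Q)%N by []; clearbody N.
  have nN : (n <= N)%N by lia.
  have le_e := r s n sn; have le_e' := r' s n sn.
  have := leq_polyval q nN; have := leq_polyval q' nN.
  move=> le_q' le_q; set f := fun mk k => _.
  have [] : small_memory Q (b + ival s e * polyval G n)%N
      (foldl f (m, (1 + icost s e)%N) (iota 0 (ival s e))).1 /\
    ((foldl f (m, (1 + icost s e)%N) (iota 0 (ival s e))).2 <=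
       1 + icost s e + ival s e * (2 + polyval q N + polyval C N))%N.
    apply: (foldl_iota_ind (Inv := fun k mk =>
      small_memory Q (b + k * polyval G n)%N mk.1 /\
      (mk.2 <= 1 + icost s e + k * (2 + polyval q N + polyval C N))%N)).
      by rewrite !mul0n !addn0.
    move=> k [m1 k1] /= lt [sm1 k1le]; rewrite /f /=.
    have sn' : below (n + polyval q n)%N (set_counter s v k).
      by apply: below_set; [apply: below_le sn _; lia | lia].
    have := h Q _ m1 _ _ Q0 sn' sm1.
    case: (run c _ m1) => m2 k2 /= [sm2 k2le]; split.
      by apply: small_memory_le sm2; rewrite /G !polyvalE; lia.
    have : (k2 <= polyval C N)%N.
      apply: leq_trans k2le _; rewrite /C polyval_comp; apply: leq_polyval.
      rewrite !polyvalD polyvalM !polyvalX.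
      have : (k * polyval G n <= polyval q N * polyval G N)%N.
        by apply: leq_mul; [lia | apply: leq_polyval].
      by lia.
    by have := nbits_leS k; lia.
  move=> sm' le'; split.
    apply: small_memory_le sm'.
    by rewrite polyvalM leq_add2l leq_mul2r le_e orbT.
  apply: leq_trans le' _; rewrite polyvalD polyvalM 2!polyvalD polyvalD !polyvalC.
  by apply: leq_add; [lia | apply: leq_mul => //; lia].
Qed.

Section InputBits.
Variable D : instance.

Definition common_denominator : nat :=
  (\prod_(i < nI D) `|denq (reward i)| *
   \prod_(t < nT D) \prod_(j < nJ D) `|denq (demand t j)|)%N.

Lemma prod_le_expn_sum n (F G : 'I_n -> nat) :
  (forall i, (F i <= 2 ^ G i)%N) -> (\prod_i F i <= 2 ^ \sum_i G i)%N.
Proof. by move=> h; rewrite expn_sum; apply: leq_prod. Qed.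

Lemma absz_denq_gt0 q : (0 < `|denq q|)%N.
Proof. by rewrite absz_gt0 denq_neq0. Qed.

Lemma common_denominator_gt0 : (0 < common_denominator)%N.
Proof.
rewrite /common_denominator muln_gt0; apply/andP; split.
  by apply: prodn_gt0 => i; apply: absz_denq_gt0.
by do 2!apply: prodn_gt0 => ?; apply: absz_denq_gt0.
Qed.

Lemma nbits_common_denominator :
  (nbits common_denominator <= (input_size D).+1)%N.
Proof.
have den q : (`|denq q| <= 2 ^ rbits q)%N.
  apply: leq_trans (ltnW (ltn_nbits _)) _.
  by rewrite leq_exp2l // leq_addl.
apply: nbits_le; apply: (@leq_trans (2 ^ (\sum_(i < nI D) rbits (reward i)
   + \sum_(t < nT D) \sum_(j < nJ D) rbits (demand t j)))); last first.
  by rewrite leq_exp2l // /input_size; lia.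
rewrite expnD; apply: leq_mul; apply: prod_le_expn_sum => i; first exact: den.
exact: prod_le_expn_sum.
Qed.

Lemma denq_common q : (`|denq q| %| common_denominator)%N ->
  q * common_denominator%:R \is a Num.int.
Proof.
move=> /dvdnP[k ->]; rewrite natrM mulrCA [X in q * X]pmulrn abszE gtr0_norm //.
by rewrite -numqE rpredM ?rpred_nat ?rpred_int.
Qed.

Lemma cell_cases p q (f : 'I_p -> 'I_q -> rat) i j :
  cell f i j = 0 \/ exists i' j', cell f i j = f i' j'.
Proof.
rewrite /cell; case: insubP => [i' _ _|_]; last by left.
by case: insubP => [j' _ _|_]; [right; exists i', j' | left].
Qed.

Lemma input_small (ties : 'M[bool]_(nT D, nI D)) :
  small_memory common_denominator (input_size D) (input_memory ties).
Proof.
have s0 : small common_denominator (input_size D) 0.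
  by split; rewrite ?mul0r ?rpred0 // normr0 exprn_ge0.
have sb (b : bool) : small common_denominator (input_size D) b%:R.
  split; first by rewrite rpredM ?rpred_nat.
  by case: b; rewrite ?normr1 ?normr0 ?exprn_ege1 ?exprn_ge0 // ler1n.
have sq q : (`|denq q| %| common_denominator)%N ->
    (rbits q <= input_size D)%N -> small common_denominator (input_size D) q.
  move=> dvd le; split; first exact: denq_common.
  by apply: le_trans (norm_le_rbits q) _; rewrite ler_weXn2l.
move=> x i j; case: x => [|[|[|[|x]]]] //=.
- case: (cell_cases (@demand D) i j) => [->//|[t [k ->]]]; apply: sq.
    rewrite dvdn_mull // (bigD1 t) //= dvdn_mulr // (bigD1 k) //=.
    exact: dvdn_mulr.
  by rewrite /input_size (bigD1 t) //= (bigD1 k) //=; lia.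
- by case: (cell_cases (fun (i : 'I_(nI D)) (j : 'I_(nJ D)) => (covers i j)%:R)
      i j) => [->//|[t [k ->]]].
- case: (cell_cases (fun (i : 'I_(nI D)) (_ : 'I_1) => reward i)
      i j) => [->//|[t [k ->]]]; apply: sq.
    by rewrite dvdn_mulr // (bigD1 t) //= dvdn_mulr.
  by rewrite /input_size (bigD1 t) //=; lia.
- by case: (cell_cases (fun (t : 'I_(nT D)) (i : 'I_(nI D)) => (ties t i)%:R)
      i j) => [->//|[t [k ->]]].
Qed.

Lemma input_below : below (input_size D) (input_counters D).
Proof.
rewrite /input_size /input_counters => -[|[|[|v]]] /=; try lia.
by rewrite nth_nil.
Qed.

End InputBits.

Theorem additive_polynomial_time (C : instance -> Prop) (P : cmd) :
  additive_cmd P -> runs_in_polynomial_time C P.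
Proof.
move=> /run_poly[p [g h]]; exists (p \Po ('X + 'X + ('X + 1%N%:P))) => D _ ties.
rewrite -[X in (_ <= X)%N]/(polyval _ _) !polyvalE /time.
have [_] := h _ _ _ _ _ (common_denominator_gt0 D) (@input_below D) (input_small ties).
move=> /leq_trans; apply; apply: leq_polyval.
by rewrite leq_add2l addn1 nbits_common_denominator.
Qed.

(** * Reasoning on runs *)
Definition exec (c : cmd) (s : counters) (m : memory) : memory := (run c s m).1.

Lemma exec_seq c1 c2 s m : exec (Seq c1 c2) s m = exec c2 s (exec c1 s m).
Proof. by rewrite /exec /=; case: (run c1 s m) => m1 k1; case: (run c2 s m1). Qed.

Lemma exec_if e1 e2 c1 c2 s m :
  exec (If e1 e2 c1 c2) s m =
  if rval s m e1 <= rval s m e2 then exec c1 s m else exec c2 s m.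
Proof. by rewrite /exec /=; case: ifP => _; case: run. Qed.

Lemma exec_for v b c s m (Inv : nat -> memory -> Prop) :
  Inv 0%N m ->
  (forall k m', (k < ival s b)%N -> Inv k m' ->
     Inv k.+1 (exec c (set_counter s v k) m')) ->
  Inv (ival s b) (exec (For v b c) s m).
Proof.
move=> I0 step; rewrite /exec /=.
apply: (foldl_iota_ind (Inv := fun k mk => Inv k mk.1)) => // k [m' c'] lt /=.
by move=> /(step _ _ lt); rewrite /exec; case: run.
Qed.

Fixpoint writes (c : cmd) : seq nat :=
  match c with
  | Skip => [::]
  | Set_ x _ _ _ => [:: x]
  | Seq c1 c2 | If _ _ c1 c2 => writes c1 ++ writes c2
  | For _ _ c1 => writes c1
  end.

Lemma exec_frame c s m x : x \notin writes c -> exec c s m x = m x.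
Proof.
elim: c s m => [|y i j e|c1 IH1 c2 IH2|e1 e2 c1 IH1 c2 IH2|v b c IH] s m //=.
- rewrite inE => /negbTE ne; rewrite /exec /= /set_cell.
  by rewrite ne.
- by rewrite mem_cat negb_or => /andP[n1 n2]; rewrite exec_seq IH2 ?IH1.
- by rewrite mem_cat negb_or exec_if => /andP[n1 n2]; case: ifP; rewrite ?IH1 ?IH2.
- move=> nx; apply: (exec_for (Inv := fun _ m' => m' x = m x)) => // k m' _ <-.
  exact: IH.
Qed.

(** * A program for the heuristic *)

(** The counter 3 is the number of periods already fixed, so the current period
    has index [nT - 1 - counter 3].  Counters 4 and 6 range over locations, and
    5 over customers.  Arrays used besides the input and the output:
    - 5, at [(n, j)], the demand of customer [j] over the first [n] periods;
    - 6, at [(j, 0)], whether a period fixed so far covers [j];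
    - 7, at [(0, 0)], the gain of the location under examination;
    - 8, at [(0, 0)], the gain of the location selected so far, or 0. *)
Definition next_period : iexp := ISub (IVar 0) (IVar 3).
Definition period : iexp := ISub next_period (ICst 1).

Definition extend_prefix : cmd :=
  For 5 (IVar 2)
    (Set_ 5 (IAdd (IVar 3) (ICst 1)) (IVar 5)
      (RAdd (RGet 5 (IVar 3) (IVar 5)) (RGet 0 (IVar 3) (IVar 5)))).

Definition compute_prefix : cmd := For 3 (IVar 0) extend_prefix.

(** Testing that coverage is at most the served flag excludes exactly the
    customers that are covered and not yet served, without a product. *)
Definition add_up_gain : cmd :=
  For 5 (IVar 2)
    (If (RGet 1 (IVar 4) (IVar 5)) (RGet 6 (IVar 5) (ICst 0)) Skip
       (Set_ 7 (ICst 0) (ICst 0)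
         (RAdd (RGet 7 (ICst 0) (ICst 0)) (RGet 5 next_period (IVar 5))))).

Definition compute_gain : cmd :=
  Seq (Set_ 7 (ICst 0) (ICst 0) (RCst 0)) add_up_gain.

Definition clear_row : cmd :=
  For 6 (IVar 1) (Set_ 4 period (IVar 6) (RCst 0)).

Definition select_location : cmd :=
  Seq clear_row
   (Seq (Set_ 4 period (IVar 4) (RCst 1))
        (Set_ 8 (ICst 0) (ICst 0) (RGet 7 (ICst 0) (ICst 0)))).

(** Preferring a set tie bit on equal gains, even to the initial empty row of gain
    0, is what puts every output of the heuristic within reach. *)
Definition compare_location : cmd :=
  If (RGet 3 period (IVar 4)) (RCst 0)
    (If (RGet 7 (ICst 0) (ICst 0)) (RGet 8 (ICst 0) (ICst 0))
       Skip select_location)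
    (If (RGet 8 (ICst 0) (ICst 0)) (RGet 7 (ICst 0) (ICst 0))
       select_location Skip).

Definition examine_locations : cmd :=
  For 4 (IVar 1) (Seq compute_gain compare_location).

Definition choose_location : cmd :=
  Seq (Set_ 8 (ICst 0) (ICst 0) (RCst 0)) examine_locations.

Definition mark_customer : cmd :=
  For 4 (IVar 1)
    (If (RAdd (RGet 1 (IVar 4) (IVar 5)) (RGet 4 period (IVar 4))) (RCst 1)
       Skip (Set_ 6 (IVar 5) (ICst 0) (RCst 1))).

Definition mark_served : cmd := For 5 (IVar 2) mark_customer.

Definition greedy_program : cmd :=
  Seq compute_prefix (For 3 (IVar 0) (Seq choose_location mark_served)).

Lemma greedy_program_additive : additive_cmd greedy_program.
Proof. by []. Qed.

Lemma big_nat_last (F : nat -> rat) n :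
  \sum_(0 <= i < n.+1) F i = \sum_(0 <= i < n) F i + F n.
Proof. exact: big_nat_recr. Qed.

Lemma compute_prefixP s m : (forall j, m 5%N 0%N j = 0) ->
  forall n j, (n <= s 0%N)%N -> (j < s 2)%N ->
  exec compute_prefix s m 5 n j = \sum_(0 <= t < n) m 0%N t j.
Proof.
move=> m0; pose Inv k (m' : memory) := m' 0%N = m 0%N /\
  forall n j, (n <= k)%N -> (j < s 2)%N -> m' 5%N n j = \sum_(0 <= t < n) m 0%N t j.
suff [] : Inv (s 0%N) (exec compute_prefix s m) by [].
apply: (exec_for (Inv := Inv)).
  by split=> // n j; rewrite leqn0 => /eqP -> _; rewrite big_geq.
move=> k m1 ltk [m10 m15].
pose Inv2 l (m' : memory) := [/\ m' 0%N = m 0%N,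
  (forall n j, (n <= k)%N -> (j < s 2)%N ->
      m' 5%N n j = \sum_(0 <= t < n) m 0%N t j) &
  forall j, (j < l)%N -> m' 5%N k.+1 j = \sum_(0 <= t < k.+1) m 0%N t j].
have [m20 m25 m25k] : Inv2 (s 2%N) 
    (exec extend_prefix (set_counter s 3 k) m1).
  apply: (exec_for (Inv := Inv2)) => //= l m2 ltl [m20 m25 m25k].
  rewrite /exec /= /set_counter /= addn1; split=> //.
    move=> n j le lt; rewrite /set_cell /= ltn_eqF //=; exact: m25.
  move=> j; rewrite ltnS /set_cell /= eqxx /=; case: eqP => [-> _|ne le].
    by rewrite big_nat_last m25 // m20.
  by apply: m25k; rewrite ltn_neqAle le andbT; apply/eqP.
split=> // n j; rewrite leq_eqVlt => /orP[/eqP-> lt|]; first exact: m25k.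
by rewrite ltnS; apply: m25.
Qed.

(** The gain as read off the tables; it equals [gain] by [score_gain] below. *)
Definition score (m : memory) (J n i : nat) : rat :=
  \sum_(0 <= j < J) (if m 1%N i j <= m 6%N j 0%N then 0 else m 5%N n j).

Lemma compute_gainP s m :
  exec compute_gain s m 7 0 0 = score m (s 2) (s 0 - s 3) (s 4).
Proof.
rewrite exec_seq /score; set m0 := exec _ _ m.
have m0x x : x != 7 -> m0 x = m x by move=> ne; apply: exec_frame; rewrite inE.
pose Inv k (m' : memory) := (forall x, x != 7 -> m' x = m x) /\
  m' 7%N 0%N 0%N = \sum_(0 <= j < k)
    (if m 1%N (s 4) j <= m 6%N j 0%N then 0 else m 5%N (s 0 - s 3)%N j).
suff [] : Inv (s 2%N) (exec add_up_gain s m0) by [].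
apply: (exec_for (Inv := Inv)); first by split=> //; rewrite big_geq.
move=> k m1 lt [m1x m17]; split=> [x ne|].
  by rewrite exec_frame ?inE // m1x.
rewrite exec_if big_nat_last /= /set_counter /= !m1x //; case: ifP => _.
  by rewrite /exec /= addr0 m17.
by rewrite /exec /set_cell /= m17 m1x.
Qed.

Section Pick.
Variables (g : nat -> rat) (tie : nat -> bool).

Definition best (o : option nat) : rat := if o is Some i then g i else 0.

(** The functional counterpart of [choose_location]; [None] is the empty row,
    whose gain is 0. *)
Fixpoint pick_location (n : nat) : option nat :=
  if n is k.+1 then
    let o := pick_location k in
    if (if tie k then best o <= g k else best o < g k) then Some k else o
  else None.

Lemma pick_location_lt n i : pick_location n = Some i -> (i < n)%N.
Proof.
elim: n => //= n IH; case: (if tie n then _ else _); first by case=> <-.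
by move=> /IH /leqW.
Qed.

Lemma pick_location_max n i : (i < n)%N -> g i <= best (pick_location n).
Proof.
elim: n => //= n IH; set b := best _ in IH *.
case: ifP => [better|/negbT worse] /=; rewrite ltnS leq_eqVlt => /orP[/eqP->|/IH].
- exact: lexx.
- by move/le_trans; apply; move: better; case: (tie n) => // /ltW.
- by move: worse; rewrite -/b; case: (tie n); rewrite -?ltNge -?leNgt // => /ltW.
- by [].
Qed.

(** With this lemma and the next, tie bits that already describe an optimal row
    make the scan return that very row. *)
Lemma pick_location_none n : (forall i, (i < n)%N -> g i <= 0 /\ ~~ tie i) ->
  pick_location n = None.
Proof.
elim: n => //= n IH h; rewrite IH => [|i /leqW]; last exact: h.
by have [le /negbTE ->] := h n (leqnn _); rewrite /= ltNge le.
Qed.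

Lemma pick_location_tie n i0 : (i0 < n)%N -> 0 <= g i0 ->
  (forall i, (i < n)%N -> g i <= g i0 /\ tie i = (i == i0)) ->
  pick_location n = Some i0.
Proof.
move=> lt0 g0; elim: n lt0 => //= n IH; rewrite ltnS leq_eqVlt => /orP[/eqP<-|lt] h.
  have [_ ->] := h i0 (leqnn _); rewrite eqxx.
  case E: (pick_location i0) => [i|] /=; last by rewrite g0.
  by have [-> _] := h i (leqW (pick_location_lt E)).
rewrite IH // => [|i /leqW]; last exact: h.
have [le ->] := h n (leqnn _).
by rewrite gtn_eqF //= ltNge le.
Qed.

End Pick.

Lemma select_locationP s m t : t = (s 0 - s 3 - 1)%N -> (s 4 < s 1)%N ->
  let m' := exec select_location s m in
  [/\ forall t' i, t' != t -> m' 4%N t' i = m 4%N t' i,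
      forall i, (i < s 1)%N -> m' 4%N t i = (i == s 4)%:R &
      m' 8%N 0%N 0%N = m 7%N 0%N 0%N].
Proof.
move=> tE lt4; rewrite exec_seq; set m1 := exec clear_row s m.
have m17 : m1 7%N = m 7%N by apply: exec_frame.
pose Inv k (m' : memory) :=
  (forall t' i, t' != t -> m' 4%N t' i = m 4%N t' i) /\
  forall i, (i < k)%N -> m' 4%N t i = 0.
have [m1o m1t] : Inv (s 1%N) m1.
  apply: (exec_for (Inv := Inv)) => // k m2 _ [m2o m2t].
  rewrite /exec /= /set_counter /= -tE; split=> [t' i ne|i].
    by rewrite /set_cell /= (negbTE ne) /= m2o.
  rewrite ltnS /set_cell /= eqxx /=; case: eqP => // ne le.
  by apply: m2t; rewrite ltn_neqAle le andbT; apply/eqP.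
rewrite exec_seq /exec /= -tE /set_cell /=; split.
- by move=> t' i ne; rewrite (negbTE ne) m1o.
- by move=> i lt; rewrite eqxx /=; case: eqP => // _; apply: m1t.
- by rewrite m17.
Qed.

Lemma choose_locationP s m t (tie : nat -> bool) : t = (s 0 - s 3 - 1)%N ->
  (forall i, (i < s 1)%N -> m 4%N t i = 0) ->
  (forall i, (i < s 1)%N -> m 3%N t i = (tie i)%:R) ->
  let m' := exec choose_location s m in
  (forall t' i, t' != t -> m' 4%N t' i = m 4%N t' i) /\
  (forall i, (i < s 1)%N -> m' 4%N t i =
     (pick_location (score m (s 2) (s 0 - s 3)) tie (s 1) == Some i)%:R).
Proof.
move=> tE m4 mtie; rewrite exec_seq; set m0 := exec _ _ m.
set g := score m (s 2) (s 0 - s 3)%N.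
have m0x x : x != 8 -> m0 x = m x by move=> ne; apply: exec_frame; rewrite inE.
pose Inv k (m' : memory) := [/\
  forall x, x \notin [:: 4; 7; 8]%N -> m' x = m x,
  m' 8%N 0%N 0%N = best g (pick_location g tie k),
  forall t' i, t' != t -> m' 4%N t' i = m 4%N t' i &
  forall i, (i < s 1)%N -> m' 4%N t i = (pick_location g tie k == Some i)%:R].
suff [] : Inv (s 1%N) (exec examine_locations s m0) by [].
apply: (exec_for (Inv := Inv)).
  split=> [x nx|//|t' i _|i lt]; last by rewrite m0x ?m4.
    by apply: m0x; move: nx; rewrite !inE; lia.
  by rewrite m0x.
move=> k m1 /= ltk [m1x m18 m14o m14t]; rewrite exec_seq.
set s' := set_counter s 4 k; set m2 := exec compute_gain s' m1.
have m27 : m2 7%N 0%N 0%N = g k.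
  rewrite /m2 compute_gainP /g /score /s' /set_counter /=.
  by apply: eq_bigr => j _; rewrite !m1x.
have m2x x : x != 7 -> m2 x = m1 x.
  by move=> ne; apply: exec_frame; rewrite /= !inE orbb.
set m3 := exec compare_location s' m2.
have m3x x : x \notin [:: 4; 7; 8]%N -> m3 x = m x.
  move=> nx; rewrite /m3 exec_frame; last by move: nx; rewrite !inE; lia.
  by rewrite m2x ?m1x //; move: nx; rewrite !inE; lia.
have m3E : m3 = if (if tie k then best g (pick_location g tie k) <= g k
                   else best g (pick_location g tie k) < g k)
               then exec select_location s' m2 else m2.
  rewrite /m3 /compare_location !exec_if /=.
  rewrite (_ : s' 0%N = s 0%N) // (_ : s' 3%N = s 3%N) // -tE.
  rewrite (_ : s' 4%N = k) // m27 !m2x // m18 m1x // mtie //.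
  by case: (tie k); rewrite ?ler10 ?lexx //; case: leP.
move: m3x; rewrite m3E /Inv /=; case: ifP => better m3x /=.
  have [//|m4o m4t m48] := @select_locationP s' m2 t tE.
  split=> // [|t' i ne|i lt].
  - by rewrite m48 m27.
  - by rewrite m4o // m2x // m14o.
  - by rewrite m4t // eq_sym.
split=> // [|t' i ne|i lt].
- by rewrite m2x.
- by rewrite m2x // m14o.
- by rewrite m2x // m14t.
Qed.

Lemma mark_servedP s m t : t = (s 0 - s 3 - 1)%N ->
  forall j, (j < s 2)%N -> exec mark_served s m 6 j 0 =
    if has (fun i => 1 < m 1 i j + m 4 t i) (iota 0 (s 1)) then 1 else m 6 j 0.
Proof.
move=> tE; pose p j i := 1 < m 1 i j + m 4 t i.
have hasS j k : has (p j) (iota 0 k.+1) = has (p j) (iota 0 k) || p j k.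
  by rewrite -addn1 iotaD has_cat /= orbF.
pose Inv k (m' : memory) :=
  [/\ m' 1%N = m 1%N, m' 4%N = m 4%N &
   forall j, (j < s 2)%N -> m' 6%N j 0%N =
     if (j < k)%N && has (p j) (iota 0 (s 1)) then 1 else m 6%N j 0%N].
suff [_ _ h] : Inv (s 2%N) (exec mark_served s m).
  by move=> j lt; rewrite h // lt.
apply: (exec_for (Inv := Inv)) => // k m1 ltk [m11 m14 m16].
pose Inv2 l (m' : memory) :=
  [/\ m' 1%N = m 1%N, m' 4%N = m 4%N,
   forall j, j != k -> m' 6%N j 0%N = m1 6%N j 0%N &
   m' 6%N k 0%N = if has (p k) (iota 0 l) then 1 else m 6%N k 0%N].
set s' := set_counter s 5 k.
have [m21 m24 m26o m26k] : Inv2 (s' 1%N) (exec mark_customer s' m1).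
  apply: (exec_for (Inv := Inv2)); first by split; rewrite //= m16 // ltnn.
  move=> l m2 ltl [m21 m24 m26o m26k]; rewrite exec_if.
  rewrite /s' /set_counter /= -tE m21 m24 /Inv2 hasS /p.
  case: lerP => _; rewrite ?orbF ?orbT; first by [].
  by rewrite /exec /= /set_cell /= !eqxx; split=> // j ne; rewrite (negbTE ne) m26o.
split=> // j lt; rewrite ltnS leq_eqVlt; have [->|ne] := eqVneq j k.
  by rewrite m26k.
by rewrite m26o // m16.
Qed.

Section Implementation.
Variables (D : instance) (R : rat).
Hypotheses (R_gt0 : 0 < R) (rewardE : forall i : 'I_(nI D), reward i = R).
Variable ties : 'M[bool]_(nT D, nI D).
Let s := input_counters D.
Let m0 := input_memory ties.
Let m1 := exec compute_prefix s m0.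

Lemma cellE p q (f : 'I_p -> 'I_q -> rat) (i : 'I_p) (j : 'I_q) :
  cell f i j = f i j.
Proof. by rewrite /cell !valK. Qed.

Lemma prefix_table n (j : 'I_(nJ D)) : (n <= nT D)%N ->
  m1 5%N n j = prefix_demand n j.
Proof.
move=> le; rewrite /m1 compute_prefixP ?ltn_ord // big_mkord.
rewrite (big_ord_widen (nT D) (fun t => m0 0%N t j) le).
by apply: eq_bigr => t _; apply: cellE.
Qed.

Lemma score_gain m (y : policy D) (t : 'I_(nT D)) (i : 'I_(nI D)) :
  m 1%N = m0 1%N -> m 5%N = m1 5%N ->
  (forall j : 'I_(nJ D), m 6%N j 0%N = (reached y t.+1 j)%:R) ->
  score m (nJ D) t.+1 i = gain y t i.
Proof.
move=> m_1 m_5 m_6; rewrite /score big_mkord; apply: eq_bigr => j _.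
rewrite m_1 m_5 m_6 prefix_table // [m0 _ _ _]cellE ler_nat.
by case: (covers i j); case: (reached y t.+1 j); rewrite ?mul1r ?mul0r.
Qed.

(** The last clause serves completeness: with an output of the heuristic as tie
    bits, the program reproduces this output row by row. *)
Definition loop_state (k : nat) (m : memory) : Prop := exists y : policy D,
  [/\ backward_greedy (nT D - k) y,
      forall x, x \notin [:: 4; 6; 7; 8]%N -> m x = m1 x,
      forall (t : 'I_(nT D)) (i : 'I_(nI D)), m 4%N t i = (y t i)%:R,
      forall j : 'I_(nJ D), m 6%N j 0%N = (reached y (nT D - k) j)%:R &
      heuristic_output ties ->
        forall (t : 'I_(nT D)) i, (nT D - k <= t)%N -> y t i = ties t i].

Lemma m1_frame x : x != 5 -> m1 x = m0 x.
Proof. by move=> ne; apply: exec_frame; rewrite inE. Qed.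

Lemma loop_start : loop_state 0 m1.
Proof.
exists (zero_policy D); rewrite subn0; split=> //.
- exact: BackwardGreedyStart.
- by move=> t i; rewrite m1_frame // mxE.
- by move=> j; rewrite m1_frame // reached_end.
- by move=> _ t i; rewrite leqNgt ltn_ord.
Qed.

Lemma pick_location_row n (o : option nat) :
  (\sum_(i < n) (o == Some (i : nat)) <= 1)%N.
Proof.
case: o => [k|]; last by rewrite big1.
have [lt|ge] := ltnP k n; last first.
  by rewrite big1 // => i _; case: eqP => // -[e]; move: ge; rewrite e leqNgt ltn_ord.
rewrite (bigD1 (Ordinal lt)) //= eqxx big1 // => i ne.
by case: eqP => // -[e]; case/eqP: ne; apply: val_inj.
Qed.

Lemma loop_step k m : (k < nT D)%N -> loop_state k m ->
  loop_state k.+1 (exec (Seq choose_location mark_served) (set_counter s 3 k) m).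
Proof.
move=> ltk [y [gr mx m4 m6 tiesP]].
have ltn : (nT D - k - 1 < nT D)%N by lia.
(* iteration k treats the period of index nT - 1 - k *)
pose t := Ordinal ltn; have tE : (nT D - k)%N = t.+1 by rewrite /=; lia.
have tE' : (nT D - k.+1)%N = t by rewrite /=; lia.
rewrite tE in gr m6 tiesP; rewrite /loop_state tE'.
have [fy y0 _ _] := backward_greedyP R_gt0 rewardE gr.
rewrite exec_seq; set s' := set_counter s 3 k.
have locations : s' 1%N = nI D by [].
have customers : s' 2%N = nJ D by [].
have periods : (s' 0 - s' 3)%N = t.+1 by rewrite -tE.
set m2 := exec choose_location s' m.
pose tie i := m0 3%N t i == 1.
have tieE (i : 'I_(nI D)) : tie i = ties t i.
  by rewrite /tie [m0 _ _ _]cellE; case: (ties t i).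
pose g := score m (nJ D) t.+1.
have gE (i : 'I_(nI D)) : g i = gain y t i.
  by apply: score_gain => //; rewrite mx ?inE // m1_frame.
set o := pick_location g tie (nI D).
have [m24o m24t] : (forall t' i, t' != t :> nat -> m2 4%N t' i = m 4%N t' i) /\
    forall i, (i < nI D)%N -> m2 4%N t i = (o == Some i)%:R.
  have := @choose_locationP s' m t tie erefl.
  rewrite locations customers periods -/g -/o; apply.
  - by move=> i lt; rewrite (m4 t (Ordinal lt)) y0.
  - move=> i lt; rewrite mx ?inE // m1_frame //.
    by rewrite -[i]/(nat_of_ord (Ordinal lt)) tieE [m0 _ _ _]cellE.
have m2x x : x \notin [:: 4; 7; 8]%N -> m2 x = m x.
  by move=> nx; apply: exec_frame; move: nx; rewrite /= !inE; lia.
pose w := with_row y t (fun i : 'I_(nI D) => o == Some (i : nat)).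
have fw : feasible w by apply: with_row_feasible => //; apply: pick_location_row.
have agr : agree_off t y w by apply: with_row_agree.
have wt i : w t i = (o == Some (i : nat)) by rewrite mxE eqxx.
have wE (t' : 'I_(nT D)) (i : 'I_(nI D)) : m2 4%N t' i = (w t' i)%:R.
  by rewrite mxE; case: (eqVneq t' t) => [->|ne]; rewrite ?m24t // m24o.
exists w; split.
- (* the row of the picked location gains the maximum over all locations *)
  apply: BackwardGreedyStep gr _; apply/(best_atP w R_gt0 rewardE fy y0); split=> //.
  move=> i; rewrite (agree_off_gain _ agr) -gE.
  apply: le_trans (pick_location_max g tie (ltn_ord i)) _; rewrite -/o.
  case E: o => [i0|] /=; last first.
    by apply: sumr_ge0 => i' _; rewrite mulr_ge0 ?gain_ge0.
  have lt0 := pick_location_lt E; pose i1 := Ordinal lt0.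
  rewrite -[i0]/(nat_of_ord i1) gE -(agree_off_gain _ agr) /row_gain.
  rewrite (bigD1 i1) //= wt E eqxx mul1r lerDl.
  by apply: sumr_ge0 => i' _; rewrite mulr_ge0 ?gain_ge0.
- move=> x nx; rewrite exec_frame; last by move: nx; rewrite /= !inE; lia.
  by rewrite m2x ?mx //; move: nx; rewrite !inE; lia.
- by move=> t' i; rewrite exec_frame // wE.
- move=> j; rewrite (@mark_servedP s' m2 t erefl) ?customers // locations.
  rewrite (m2x 1%N) // (m2x 6%N) // (mx 1%N) // m1_frame // m6.
  rewrite reached_rec (agree_off_reached _ agr).
  rewrite (_ : has _ _ = covered w t j).
    by case: (covered w t j).
  apply/hasP/existsP => [[i]|[i /andP[ci wi]]].
    rewrite mem_iota add0n => /= lti gt1; pose i' := Ordinal lti.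
    have {gt1} : 1 < m0 1%N i' j + m2 4%N t i' := gt1.
    rewrite wE [m0 _ _ _]cellE => gt1; exists i'; move: gt1.
    by case: (covers _ j); case: (w t _).
  exists (nat_of_ord i); first by rewrite mem_iota ltn_ord.
  by rewrite wE [m0 _ _ _]cellE ci wi.
- (* above t the rows agree, so the gains at t do; then the tie bits decide *)
  move=> out t' i; rewrite leq_eqVlt => /orP[/eqP/val_inj<-|lt]; last first.
    by rewrite (agree_off_above agr) // tiesP.
  have [fties _ grties _] := backward_greedyP R_gt0 rewardE out.
  have gE' i' : gain ties t i' = g i'.
    by rewrite gE; apply: eq_gain => s1 i1 lt; rewrite tiesP.
  have := grties t isT; rewrite wt.
  have rowP := at_most_one_cases (feasible_row t fties).
  have rowE := at_most_one_sum (gain ties t) rowP.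
  have {}rowE : row_gain ties ties t = _ := rowE.
  case: rowP => [none|[i0 some]] gmax.
    rewrite /o pick_location_none ?none // => i1 lt1.
    have := gmax (Ordinal lt1); rewrite -[i1]/(nat_of_ord (Ordinal lt1)) tieE none.
    by rewrite gE' rowE; case: pickP => // i2; rewrite none.
  have rowi0 : row_gain ties ties t = g i0.
    rewrite rowE; case: pickP => [i2|/(_ i0)]; rewrite some /= ?eqxx //.
    by move=> /eqP ->.
  rewrite /o (@pick_location_tie _ _ _ i0) //.
  - rewrite some /=; apply/eqP/eqP => [[e]|-> //].
    by apply/esym/val_inj.
  - by rewrite gE gain_ge0.
  - move=> i1 lt1; rewrite -[i1]/(nat_of_ord (Ordinal lt1)) tieE some -gE'.
    by split=> //; rewrite -rowi0.
Qed.

Lemma greedy_program_output : exists y : policy D,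
  [/\ returns greedy_program ties y, heuristic_output y &
      heuristic_output ties -> y = ties].
Proof.
have [y [gr _ m4 _ tiesP]] : loop_state (nT D) (exec greedy_program s m0).
  rewrite exec_seq; apply: (@exec_for 3 (IVar 0) _ s m1 loop_state).
    exact: loop_start.
  exact: loop_step.
rewrite subnn in gr tiesP; exists y; split=> //.
by move=> out; apply/matrixP => t i; apply: tiesP.
Qed.

End Implementation.

Theorem greedy_program_implements :
  implements_heuristic identical_rewards greedy_program.
Proof.
move=> D [R R0 rE]; split=> [ties|y out].
  by have [y [ret out _]] := greedy_program_output R0 rE ties; exists y.
have [w [ret _ /(_ out) e]] := greedy_program_output R0 rE y.
by exists y; rewrite -{2}e.
Qed.

(** * The approximation guarantee *)

Theorem theorem5 :
  (exists P : cmd,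
      implements_heuristic identical_rewards P
      /\ runs_in_polynomial_time identical_rewards P)
  /\ (forall D : instance, identical_rewards D ->
      forall y : policy D, heuristic_output y ->
        feasible y /\ optimum D <= 2 * objective y).
Proof.
split=> [|D [R R0 rE] y out].
  exists greedy_program; split; first exact: greedy_program_implements.
  exact/additive_polynomial_time/greedy_program_additive.
split; last exact: greedy_approx R0 rE out.
by case: (backward_greedyP R0 rE out).
Qed.
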